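(* Let $a,b\ge 1$ be integers, $m=a+b$, let $N\in\mathbb{N}$ be a fixed number of urns, and let $0<\alpha\le 1$. For $i\in\{1,\dots,N\}$, let $(Z_t(i))_{t\ge 0}$ and $(Z_t)_{t\ge 0}$ be, respectively, the fraction of red balls in urn $i$ and the total fraction of red balls in the interacting urn model with $N$ urns and parameter $\alpha$. Then the following asymptotic estimates hold: $$\mathbb{E}\left[(Z_t(i)-Z_t)^2\right]\sim\begin{cases} t^{-2\alpha} & \text{for } 0<\alpha<\tfrac12,\\ t^{-1}\log t & \text{for } \alpha=\tfrac12,\\ t^{-1} & \text{for } \tfrac12<\alpha\le 1,\end{cases}$$ where for two positive sequences $a_t,b_t$ the notation $a_t\sim b_t$ means $0<\liminf_{t\to+\infty}\frac{a_t}{b_t}\le\limsup_{t\to+\infty}\frac{a_t}{b_t}<+\infty$.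
   Context: Interacting urn model. Let $a,b\ge 1$ be integers (initial numbers of red and white balls in each urn), $m=a+b$, $N\in\mathbb{N}$ the number of urns, and $\alpha\in[0,1]$. Let $\{U(t,i): t,i\in\mathbb{N}\}$ be i.i.d. random variables uniform on $[0,1]$, and $\mathcal{F}_t=\sigma(U(s,i): 0\le s\le t,\ i\in\mathbb{N})$. For $i=1,\dots,N$ set $X_0(i)=a$, $Z_0(i)=a/m$, and for $t\ge 0$ $$Z_t=\frac1N\sum_{j=1}^N Z_t(j),\qquad Y_t(i)=\mathbf{1}_{\{U(t+1,i)\le \alpha Z_t+(1-\alpha)Z_t(i)\}},$$ $$X_{t+1}(i)=X_t(i)+Y_t(i),\qquad Z_{t+1}(i)=\frac{X_{t+1}(i)}{t+1+m}=\frac{t+m}{t+m+1}Z_t(i)+\frac{1}{t+m+1}Y_t(i).$$ Thus $X_t(i)$ and $Z_t(i)$ are the number and fraction of red balls in urn $i$ at time $t$, and $Z_t$ is the total fraction of red balls. The dependence on $N$ is omitted from the notation.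
   Formalization: The number of urns N is assumed to be at least 2; for N = 1 one has Z_t(1) = Z_t, so the expectation is identically 0 and the stated estimates fail. *)

(* Defs.v *)
From HB Require Import structures.
From mathcomp Require Import all_boot all_order all_algebra.
From mathcomp Require Import all_classical all_reals all_analysis.
Set Implicit Arguments.
Unset Strict Implicit.
Unset Printing Implicit Defensive.
Import Order.TTheory GRing.Theory Num.Theory.
Import numFieldNormedType.Exports.
Local Open Scope classical_set_scope.
Local Open Scope ring_scope.

Section independence.
Context {d : measure_display} {T : measurableType d} {R : realType}.
Variable P : probability T R.

Definition mutually_independent (I : choiceType) (X : I -> {RV P >-> R}) :=
  forall (s : seq I) (B : I -> set R),
    uniq s -> (forall k, measurable (B k)) ->
    P (\bigcap_(k in [set` s]) (X k @^-1` B k))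
    = (\prod_(k <- s) P (X k @^-1` B k))%E.

Definition uniform01 (X : {RV P >-> R}) :=
  forall B : set R, measurable B ->
    distribution P X B = uniform_prob (@ltr01 R) B.

(* [U t i] stands for U(t,i); independence is joint in the pair (t,i). *)
Definition iid_uniform01 (U : nat -> nat -> {RV P >-> R}) :=
  mutually_independent (fun k : nat * nat => U k.1 k.2) /\
  (forall t i, uniform01 (U t i)).

End independence.

(* The urns are indexed by 'I_N, i.e. numbered from 0. The dynamics is defined
   for one realisation [u] of the family U. *)
Section urn_path.
Context {R : realType}.
Variables (a b N : nat) (alpha : R).

Definition red_fraction (t x : nat) : R := x%:R / (t + (a + b))%:R.

Definition urn_average (z : 'I_N -> R) : R := N%:R^-1 * \sum_(j < N) z j.

Fixpoint urn_red (u : nat -> nat -> R) (t : nat) (i : 'I_N) : nat :=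
  match t with
  | 0 => a
  | s.+1 =>
    let z j := red_fraction s (urn_red u s j) in
    (urn_red u s i
      + (u s.+1 i <= alpha * urn_average z + (1 - alpha) * z i)%R)%N
  end.

Definition urn_frac (u : nat -> nat -> R) (t : nat) (i : 'I_N) : R :=
  red_fraction t (urn_red u t i).

Definition total_frac (u : nat -> nat -> R) (t : nat) : R :=
  urn_average (urn_frac u t).

End urn_path.

(* The liminf and limsup are taken in \bar R, so that the upper bound is a
   genuine finiteness condition. *)
Definition same_order {R : realType} (x : (\bar R)^nat) (y : R^nat) : Prop :=
  let r t := (x t * ((y t)^-1)%:E)%E in
  [/\ (0 < limn_einf r)%E, (limn_einf r <= limn_esup r)%E
    & (limn_esup r < +oo)%E].

(* Main.v *)
Require Import Defs.
From HB Require Import structures.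
From mathcomp Require Import all_boot all_order all_algebra.
From mathcomp Require Import all_classical all_reals all_analysis.
From mathcomp Require Import ring lra.
Import Order.TTheory GRing.Theory Num.Theory.
Import numFieldNormedType.Exports.
Local Open Scope classical_set_scope.
Local Open Scope ring_scope.

(** Let n = t + m + 1 and let V_t = Z_t(i) - Z_t. Then n V_(t+1) is
    (n - 1) V_t plus the difference of Y_t(i) and the average of the Y_t(j). Given
    the past the draws are independent, with probabilities that average to Z_t, so
    this difference has conditional mean (1 - alpha) V_t. Hence x_t = E[V_t^2] obeys
    the exact recursion [urn_mean_deviationS]

      x_(t+1) = (1 - alpha / n)^2 x_t + v_t / n^2,

    where v_t is the mean of the conditional variance of this difference.

    The second input is that v_t stays between two positive constants
    ([urn_mean_noise_itv]). It is at most 1. For the lower bound, every drawing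
    probability p satisfies p >= alpha Z_t and 1 - p >= alpha (1 - Z_t), so the
    conditional variance is at least a multiple of Z_t (1 - Z_t). As Z_t is a
    martingale with conditional variance at most Z_t (1 - Z_t) / n^2, the mean of
    Z_t (1 - Z_t) is multiplied at each step by at least 1 - 1 / n^2, and the
    product of these factors converges to a positive number
    ([urn_mean_spread_ge]).

    What remains concerns real sequences. The recursion is monotone, so x_t is
    trapped between explicit subsolutions and supersolutions. The noise alone
    produces the order 1 / t and the effect of early fluctuations decays as
    t^(- 2 alpha); the slower of the two wins, and a logarithm appears at
    alpha = 1/2, where they agree ([damped_supercritical], [damped_critical],
    [damped_subcritical]).

    The expectations are reduced to finite sums. The state at time t is a
    function of the finite history of draws; mutual independence of the uniform
    variables gives each history the product of the Bernoulli weights of its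
    draws ([prob_history_event]), so the moments above are computed with sums
    over histories ([expectation_urn]). *)

Set Implicit Arguments.
Unset Strict Implicit.
Unset Printing Implicit Defensive.

(** * Comparison for the second-moment recursion *)

(** Concavity of the power function, from its tangent line at 1. Writing s for
    alpha * ln z, both z and 1 are e^s times an exponential, each bounded below
    by its own tangent; the weights alpha and 1 - alpha cancel the linear terms. *)
Lemma powR_le_tangent1 {R : realType} (alpha z : R) :
  0 <= alpha <= 1 -> 0 < z -> z `^ alpha <= 1 + alpha * (z - 1).
Proof.
move=> /andP[a0 a1] z0; rewrite /powR gt_eqF//.
set s := alpha * ln z; have es0 := expR_gt0 s.
have hz : expR s * (1 + (ln z - s)) <= z.
  rewrite [leRHS](_ : z = expR s * expR (ln z - s)); last by rewrite -expRD subrKC lnK.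
  by rewrite ler_pM2l// expR_ge1Dx.
have h1 : expR s * (1 - s) <= 1.
  rewrite -[leRHS](expRxMexpNx_1 s) ler_pM2l//; exact: expR_ge1Dx.
have -> : expR s = alpha * (expR s * (1 + (ln z - s))) + (1 - alpha) * (expR s * (1 - s)).
  by rewrite /s; ring.
have -> : 1 + alpha * (z - 1) = alpha * z + (1 - alpha) * 1 by ring.
by apply: lerD; apply: ler_wpM2l => //; rewrite subr_ge0.
Qed.

Lemma ln_increment {R : realType} (s : R) : 0 < s ->
  (s + 1)^-1 <= ln (s + 1) - ln s <= s^-1.
Proof.
move=> s0; have s10 : 0 < s + 1 by lra.
apply/andP; split.
  rewrite -lerN2 opprB -ln_div ?posrE//.
  have -> : s / (s + 1) = 1 + - (s + 1)^-1 by field; rewrite gt_eqF.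
  by apply: le_ln1Dx; rewrite ltrN2 invf_lt1//; lra.
rewrite -ln_div ?posrE//.
have -> : (s + 1) / s = 1 + s^-1 by field; rewrite gt_eqF.
apply: le_ln1Dx; have : 0 < s^-1 by rewrite invr_gt0.
by lra.
Qed.

(** Two-sided domination up to constants: the elementary form of the relation
    that the liminf and limsup of the quotient express. *)
Definition comparable_eventually {R : realType} (x z : nat -> R) :=
  exists k K : R, exists T : nat, [/\ 0 < k, 0 < K &
    forall t, (T <= t)%N -> k * z t <= x t <= K * z t].

Section recursion.
Context {R : realType}.
Variable alpha : R.
Hypotheses (alpha0 : 0 < alpha) (alpha1 : alpha <= 1).

(** The second moment of the deviation follows this map, r being the total number
    of balls in an urn. It behaves as the differential equation
    x' = - 2 alpha x / r + w / r^2, whose solutions combine r^(- 2 alpha) and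
    1 / r, or ln r / r when the two exponents coincide. *)
Definition damped_step (r x w : R) : R :=
  (1 - alpha / (r + 1)) ^+ 2 * x + w / (r + 1) ^+ 2.

Lemma damped_step_le (r x x' w w' : R) : x <= x' -> w <= w' ->
  damped_step r x w <= damped_step r x' w'.
Proof.
move=> xx' ww'; apply: lerD; first by rewrite ler_wpM2l// sqr_ge0.
by rewrite ler_wpM2r// invr_ge0 sqr_ge0.
Qed.

(** The function K / r is a supersolution or a subsolution according to the sign
    of the numerator on the right, in which (1 - alpha)^2 / r is negligible: what
    decides is the sign of 2 alpha - 1, and the size of K. *)
Lemma damped_step_inv (K w r : R) : 0 < r ->
  K / (r + 1) - damped_step r (K / r) w
  = (K * (2 * alpha - 1 - (1 - alpha) ^+ 2 / r) - w) / (r + 1) ^+ 2.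
Proof.
by move=> r0; rewrite /damped_step; field; apply/andP; split; lra.
Qed.

Let powRN_double (x : R) : x `^ (- (2 * alpha)) = (x `^ (- alpha)) ^+ 2.
Proof. by rewrite -powR_mulrn ?powR_ge0// -powRrM; congr (_ `^ _); ring. Qed.

(** Without noise, r^(- 2 alpha) is a subsolution: (1 - 1 / (r + 1))^alpha lies
    below its tangent. *)
Lemma damped_step_powN (r : R) : 0 < r ->
  (r + 1) `^ (- (2 * alpha)) <= (1 - alpha / (r + 1)) ^+ 2 * r `^ (- (2 * alpha)).
Proof.
move=> r0; have r10 : 0 < r + 1 by lra.
rewrite !powRN_double -exprMn ler_pXn2r// ?nnegrE ?powR_ge0//; last first.
  rewrite mulr_ge0 ?powR_ge0// subr_ge0 ler_pdivrMr//; move: alpha1; lra.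
have := @powR_le_tangent1 R alpha (r / (r + 1)).
rewrite ltW//= alpha1 divr_gt0// => /(_ isT isT).
have -> : r / (r + 1) - 1 = - (r + 1)^-1 by field; rewrite gt_eqF.
rewrite mulrN => h; apply: le_trans (ler_wpM2r (powR_ge0 r (- alpha)) h).
rewrite powRM ?invr_ge0 ?(ltW r0) ?(ltW r10)// mulrAC (powRN r) mulfV
  ?mul1r ?gt_eqF ?powR_gt0//.
by rewrite -(powR_inv1 (ltW r10)) -powRrM mulN1r.
Qed.

(** Without noise, the shifted power (r + 1)^(- 2 alpha) is a supersolution, with
    s for r + 1. The shift gives room to invert the tangent bound on
    (1 + 1 / s)^alpha, since (1 - alpha / s) (1 + alpha / s) <= 1. *)
Lemma damped_step_pow_shift (s : R) : 1 <= s ->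
  (1 - alpha / s) ^+ 2 * s `^ (- (2 * alpha)) <= (s + 1) `^ (- (2 * alpha)).
Proof.
move=> s1; have s0 : 0 < s by lra.
have as0 : 0 <= 1 - alpha / s by rewrite subr_ge0 ler_pdivrMr//; move: alpha1; lra.
rewrite !powRN_double -exprMn ler_pXn2r// ?nnegrE ?powR_ge0//; last first.
  by rewrite mulr_ge0 ?powR_ge0.
have s10 : 0 < (s + 1) / s by rewrite divr_gt0//; lra.
have := @powR_le_tangent1 R alpha ((s + 1) / s).
rewrite ltW//= alpha1 s10 => /(_ isT isT).
have -> : (s + 1) / s - 1 = s^-1 by field; rewrite gt_eqF.
move=> h.
have -> : s + 1 = s * ((s + 1) / s) by field; rewrite gt_eqF.
rewrite powRM ?(ltW s0) ?(ltW s10)// mulrC ler_wpM2l ?powR_ge0// powRN.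
rewrite -[leRHS]mul1r ler_pdivlMr ?powR_gt0//.
apply: le_trans (ler_wpM2l as0 h) _.
have -> : (1 - alpha / s) * (1 + alpha / s) = 1 - (alpha / s) ^+ 2 by ring.
by rewrite lerBlDr lerDl sqr_ge0.
Qed.

Variables (m : nat) (c : R) (y v : nat -> R).
Hypotheses (m2 : (2 <= m)%N) (c0 : 0 < c) (y0 : 0 <= y 0%N).
Hypothesis hv : forall t, c <= v t <= 1.
Let r t : R := (t + m)%:R.
Hypothesis yS : forall t, y t.+1 = damped_step (r t) (y t) (v t).

Let rS t : r t.+1 = r t + 1.
Proof. by rewrite /r addSn -natr1. Qed.

Let r_ge2 t : 2 <= r t.
Proof. by rewrite /r ler_nat; apply: (leq_trans m2); rewrite leq_addl. Qed.

Let r_gt0 t : 0 < r t. Proof. exact: lt_le_trans (r_ge2 t). Qed.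

(** Comparison principle: the step is monotone in both arguments, so an inequality
    that holds at one time and is preserved by the step holds for ever. *)
Lemma le_supersolution (g : R -> R) (t0 : nat) :
  (forall t, (t0 <= t)%N -> damped_step (r t) (g (r t)) 1 <= g (r t + 1)) ->
  y t0 <= g (r t0) -> forall t, (t0 <= t)%N -> y t <= g (r t).
Proof.
move=> hg h0; elim=> [|t IH]; first by rewrite leqn0 => /eqP t00; move: h0; rewrite t00.
rewrite leq_eqVlt => /predU1P[<-//|]; rewrite ltnS => t0t.
rewrite yS rS; apply: le_trans (hg _ t0t).
by apply: damped_step_le; [exact: IH|case/andP: (hv t)].
Qed.

Lemma ge_subsolution (g : R -> R) (t0 : nat) :
  (forall t, (t0 <= t)%N -> g (r t + 1) <= damped_step (r t) (g (r t)) c) ->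
  g (r t0) <= y t0 -> forall t, (t0 <= t)%N -> g (r t) <= y t.
Proof.
move=> hg h0; elim=> [|t IH]; first by rewrite leqn0 => /eqP t00; move: h0; rewrite t00.
rewrite leq_eqVlt => /predU1P[<-//|]; rewrite ltnS => t0t.
rewrite yS rS; apply: le_trans (hg _ t0t) _.
by apply: damped_step_le; [exact: IH|case/andP: (hv t)].
Qed.

(** The sequence may start at 0, as it does for the urns, so subsolutions are
    compared with it from time 1 on. *)
Lemma damped_gt0 : 0 < y 1%N.
Proof.
rewrite yS; apply: ltr_wpDl; first by rewrite mulr_ge0 ?sqr_ge0.
apply: divr_gt0.
  by apply: lt_le_trans c0 _; case/andP: (hv 0).
by rewrite exprn_gt0// addr_gt0.
Qed.

(** The noise dominates: K / r is a supersolution once r >= 2 / (2 alpha - 1), for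
    K >= 2 / (2 alpha - 1), and k / r is a subsolution for every k <= c. *)
Lemma damped_supercritical : 2^-1 < alpha ->
  comparable_eventually y (fun t => (r t)^-1).
Proof.
move=> ha; set e := 2 * alpha - 1; have e0 : 0 < e by rewrite /e; lra.
have be0 : 0 <= 2 / e by rewrite divr_ge0// ltW.
pose T := (Num.bound (2 / e)).+1.
have hT t : (T <= t)%N -> 2 / e <= r t.
  move=> Tt; apply: le_trans (ltW (archi_boundP be0)) _.
  by rewrite ler_nat (leq_trans (leqnSn _))// (leq_trans Tt)// leq_addr.
pose K := Num.max (2 / e) (y T * r T).
pose k := Num.min c (y 1%N * r 1%N).
have k0 : 0 < k by rewrite lt_min c0 mulr_gt0// damped_gt0.
have K0 : 0 < K by apply: (@lt_le_trans _ _ (2 / e)); rewrite ?le_max ?lexx ?divr_gt0.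
have a2 : 0 <= (1 - alpha) ^+ 2 by rewrite sqr_ge0.
have a3 : (1 - alpha) ^+ 2 <= 1 by rewrite expr_le1//; move: alpha0 alpha1; lra.
exists k, K, T; split=> // t Tt; apply/andP; split.
  apply: (@ge_subsolution (fun r => k / r) 1%N) => [s _||]; last exact: leq_trans Tt.
    rewrite -subr_le0 damped_step_inv// pmulr_lle0 ?invr_gt0 ?exprn_gt0 ?addr_gt0//.
    rewrite subr_le0; apply: (@le_trans _ _ (k * 1)); last by rewrite mulr1 ge_min lexx.
    have : 0 <= (1 - alpha) ^+ 2 / r s by rewrite divr_ge0// ltW.
    by rewrite ler_pM2l//; move: alpha1; lra.
  by rewrite ler_pdivrMr// ge_min lexx orbT.
apply: (@le_supersolution (fun r => K / r) T) => // [s Ts|].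
  rewrite -subr_ge0 damped_step_inv// divr_ge0 ?sqr_ge0// subr_ge0.
  have h : (1 - alpha) ^+ 2 / r s <= e / 2.
    rewrite ler_pdivrMr//; apply: (le_trans a3).
    by rewrite mulrC -ler_pdivrMr ?divr_gt0// invf_div mul1r hT.
  apply: (@le_trans _ _ ((2 / e) * (e / 2))); first by rewrite mulrA divfK ?gt_eqF// divff.
  apply: ler_pM => //; first by rewrite divr_ge0// ltW.
    by rewrite le_max lexx.
  by move: h; rewrite -/e; lra.
by rewrite ler_pdivlMr// le_max lexx orbT.
Qed.

(** Resonance. Over one step (r + 1) ln r grows by (r + 1) (ln (r + 1) - ln r),
    which is between 1 and 2; up to the term ln r / (4 r) this is what balances
    the noise. *)
Lemma damped_critical : alpha = 2^-1 ->
  comparable_eventually y (fun t => ln (r t) / r t).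
Proof.
move=> ha; have ln_ge0' t : 0 <= ln (r t) by rewrite ln_ge0//; have := r_ge2 t; lra.
have hln (K w s : R) : 0 < s -> K * (ln (s + 1) / (s + 1)) - damped_step s (K * (ln s / s)) w
    = (K * ((s + 1) * (ln (s + 1) - ln s) - ln s / (4 * s)) - w) / (s + 1) ^+ 2.
  by move=> s0; rewrite /damped_step ha; field; rewrite !gt_eqF// addr_gt0.
have l2 : 0 < ln (r 1%N) by rewrite ln_gt0//; have := r_ge2 1; lra.
pose K := Num.max 2 (y 1%N / (ln (r 1%N) / r 1%N)).
pose k := Num.min (c / 2) (y 1%N / (ln (r 1%N) / r 1%N)).
have k0 : 0 < k by rewrite lt_min divr_gt0//= divr_gt0 ?damped_gt0// divr_gt0.
have K2 : 2 <= K by rewrite le_max lexx.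
exists k, K, 1%N; split=> // [|t t1]; first exact: lt_le_trans K2.
apply/andP; split.
  apply: (@ge_subsolution (fun r => k * (ln r / r)) 1%N) => // [s _|]; last first.
    by rewrite -ler_pdivlMr ?divr_gt0// ge_min lexx orbT.
  rewrite -subr_le0 hln// pmulr_lle0 ?invr_gt0 ?exprn_gt0 ?addr_gt0//.
  rewrite subr_le0; apply: (@le_trans _ _ (k * 2)); last first.
    by rewrite -ler_pdivlMr// ge_min lexx.
  rewrite ler_pM2l//.
  have : 0 <= ln (r s) / (4 * r s) by rewrite divr_ge0// mulr_ge0// ltW.
  have : (r s + 1) * (ln (r s + 1) - ln (r s)) <= 2.
    have /andP[_ h] := @ln_increment R (r s) (r_gt0 s).
    apply: le_trans (ler_wpM2l (ltW (addr_gt0 (r_gt0 s) ltr01) : 0 <= r s + 1) h) _.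
    by rewrite ler_pdivrMr//; have := r_ge2 s; lra.
  lra.
apply: (@le_supersolution (fun r => K * (ln r / r)) 1%N) => // [s _|]; last first.
  by rewrite -ler_pdivrMr ?divr_gt0// le_max lexx orbT.
rewrite -subr_ge0 hln// divr_ge0 ?sqr_ge0// subr_ge0.
have h1 : 1 <= (r s + 1) * (ln (r s + 1) - ln (r s)).
  have /andP[h _] := @ln_increment R (r s) (r_gt0 s).
  by rewrite mulrC -ler_pdivrMr ?addr_gt0// div1r.
(* Since K >= 2, these bounds leave K (1 - 1/4) >= 1. *)
have h2 : ln (r s) / (4 * r s) <= 4^-1.
  by rewrite ler_pdivrMr ?mulr_gt0// mulKf ?pnatr_eq0// ltW// ln_sublinear.
apply: (@le_trans _ _ (2 * (3 / 4))); first by lra.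
by apply: ler_pM => //; lra.
Qed.

(** The early fluctuations dominate. Below, the noise after time 1 is dropped.
    Above, the term - L / r is a particular solution that absorbs the noise: here
    2 alpha - 1 < 0, so the coefficient of 1 / r must be negative. *)
Lemma damped_subcritical : alpha < 2^-1 ->
  comparable_eventually y (fun t => r t `^ (- (2 * alpha))).
Proof.
move=> ha.
pose L := (1 - 2 * alpha)^-1.
have L0 : 0 < L by rewrite invr_gt0; lra.
pose p (s : R) := s `^ (- (2 * alpha)).
have p0 s : 0 < s -> 0 < p s by exact: powR_gt0.
pose K := (y 1%N + L / r 1%N) / p (r 1%N + 1).
have K0 : 0 < K by rewrite divr_gt0 ?p0 ?addr_gt0 ?damped_gt0// divr_gt0.
pose k := y 1%N / p (r 1%N).
have k0 : 0 < k by rewrite divr_gt0 ?p0 ?damped_gt0.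
exists k, K, 1%N; split=> // t t1; apply/andP; split.
  apply: (@ge_subsolution (fun r => k * p r) 1%N) => // [s _|]; last first.
    by rewrite divfK// gt_eqF// p0.
  apply: (@le_trans _ _ (k * ((1 - alpha / (r s + 1)) ^+ 2 * p (r s)))).
    by rewrite ler_pM2l//; exact: damped_step_powN.
  rewrite /damped_step mulrCA lerDl divr_ge0 ?sqr_ge0//; exact: ltW.
apply: (@le_trans _ _ (K * p (r t + 1) - L / r t)).
  apply: (@le_supersolution (fun r => K * p (r + 1) - L / r) 1%N) => // [s _|]; last first.
    by rewrite divfK ?addrK// gt_eqF// p0// addr_gt0.
  have -> : damped_step (r s) (K * p (r s + 1) - L / r s) 1
     = K * ((1 - alpha / (r s + 1)) ^+ 2 * p (r s + 1)) + damped_step (r s) (- L / r s) 1.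
    by rewrite /damped_step; ring.
  apply: lerD.
    by rewrite ler_pM2l//; apply: damped_step_pow_shift; have := r_ge2 s; lra.
  rewrite -mulNr -subr_ge0 damped_step_inv// divr_ge0 ?sqr_ge0// subr_ge0.
  rewrite [leLHS](_ : 1 = L * (1 - 2 * alpha)); last by rewrite mulVf// gt_eqF//; lra.
  rewrite mulNr -mulrN ler_pM2l//.
  have : 0 <= (1 - alpha) ^+ 2 / r s by rewrite divr_ge0 ?sqr_ge0// ltW.
  lra.
apply: (@le_trans _ _ (K * p (r t + 1))).
  by rewrite gerBl divr_ge0// ltW.
rewrite ler_pM2l//.
rewrite /p !powRN lef_pV2 ?posrE ?powR_gt0 ?addr_gt0//.
by rewrite ge0_ler_powR ?nnegrE ?addr_ge0 ?ltW ?mulr_gt0// ?ltrDl.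
Qed.

End recursion.

(** * Orders of magnitude *)

Lemma comparable_eventually_trans {R : realType} (x y z : nat -> R) :
  comparable_eventually x y -> comparable_eventually y z ->
  comparable_eventually x z.
Proof.
move=> [k [K [T [k0 K0 h]]]] [k' [K' [T' [k'0 K'0 h']]]].
exists (k * k'), (K * K'), (maxn T T'); split; rewrite ?mulr_gt0// => t.
rewrite geq_max => /andP[/h/andP[h1 h2] /h'/andP[h3 h4]].
rewrite -!mulrA; apply/andP; split.
  by apply: le_trans h1; rewrite ler_pM2l.
by apply: le_trans h2 _; rewrite ler_pM2l.
Qed.

(** The rates come out in terms of the number t + m of balls in an urn; these
    lemmas express them in terms of t. *)
Section shift.
Context {R : realType}.
Variable m : nat.

Let shift_le t : (1 <= t)%N -> (t + m)%:R <= m.+1%:R * t%:R :> R.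
Proof. by move=> t1; rewrite -natrM ler_nat mulSn leq_add2l leq_pmulr. Qed.

Lemma comparable_shift_powN (e : R) : 0 <= e ->
  comparable_eventually (fun t => (t + m)%:R `^ (- e)) (fun t => t%:R `^ (- e)).
Proof.
move=> e0; exists (m.+1%:R `^ (- e)), 1, 1%N; split => [| |t t1]; rewrite ?powR_gt0 ?ltr0n//.
rewrite mul1r -powRM ?ler0n// !powRN; apply/andP; split.
  rewrite lef_pV2 ?posrE ?powR_gt0 ?mulr_gt0 ?ltr0n ?addn_gt0 ?t1//.
  by rewrite ge0_ler_powR ?nnegrE ?ler0n ?mulr_ge0// shift_le.
rewrite lef_pV2 ?posrE ?powR_gt0 ?ltr0n ?addn_gt0 ?t1//.
by rewrite ge0_ler_powR ?nnegrE ?ler0n// ler_nat leq_addr.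
Qed.

Lemma comparable_shift_inv :
  comparable_eventually (fun t => (t + m)%:R^-1 : R) (fun t => t%:R^-1).
Proof.
have [k [K [T [k0 K0 h]]]] := @comparable_shift_powN 1 ler01.
exists k, K, T; split => // t Tt; have := h _ Tt.
by rewrite !powR_inv1.
Qed.

(** For t >= m + 2, ln (t + m) <= ln ((m + 1) t) <= 2 ln t. *)
Lemma comparable_shift_log :
  comparable_eventually (fun t => ln (t + m)%:R / (t + m)%:R : R)
    (fun t => t%:R^-1 * ln t%:R).
Proof.
exists m.+1%:R^-1, 2, m.+2; split => [| |t tm]; rewrite ?invr_gt0 ?ltr0n//.
have t0 : (0 < t)%N by apply: leq_trans tm.
have tR0 : 0 < t%:R :> R by rewrite ltr0n.
have sR0 : 0 < (t + m)%:R :> R by rewrite ltr0n addn_gt0 t0.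
have lt0 : 0 <= ln t%:R :> R by rewrite ln_ge0// ler1n.
have le1 : ln t%:R <= ln (t + m)%:R :> R by rewrite ler_ln ?posrE// ler_nat leq_addr.
have le2 : ln (t + m)%:R <= 2 * ln t%:R :> R.
  rewrite mulrDl !mul1r -lnM ?posrE// ler_ln ?posrE ?mulr_gt0//.
  apply: le_trans (shift_le t0) _; rewrite ler_pM2r// ler_nat.
  exact: ltnW.
apply/andP; split.
  rewrite mulrA mulrC; apply: ler_pM => //; rewrite ?mulr_ge0 ?invr_ge0//.
  by rewrite -invfM lef_pV2 ?posrE ?mulr_gt0// shift_le.
rewrite mulrCA mulrC; apply: ler_pM => //.
  by rewrite ln_ge0// ler1n addn_gt0 t0.
by rewrite lef_pV2 ?posrE// ler_nat leq_addr.
Qed.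

End shift.

(** The liminf and limsup are bounded by the infimum and the supremum over any
    tail, here one on which the domination holds and z is positive. *)
Lemma same_order_of_comparable {R : realType} (x z : nat -> R) :
  comparable_eventually x z -> (forall t, (2 <= t)%N -> 0 < z t) ->
  same_order (fun t => (x t)%:E) z.
Proof.
move=> [k [K [T [k0 K0 h]]]] z0.
pose A := [set t | (maxn T 2 <= t)%N].
have nA : \oo A by exists (maxn T 2).
have hA t : A t -> k <= x t * (z t)^-1 <= K.
  rewrite /A /= geq_max => /andP[Tt t2].
  by rewrite ler_pdivlMr ?ler_pdivrMr ?z0// h.
split; last 2 first.
- exact: limn_einf_sup.
- apply: (@le_lt_trans _ _ K%:E); last exact: ltry.
  apply: (@le_trans _ _ (ereal_sup ((fun t => ((x t)%:E * ((z t)^-1)%:E)%E) @` A))).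
    by apply: ereal_inf_lbound; exists A.
  apply: ge_ereal_sup => _ [t /= /hA /andP[_ ?] <-].
  by rewrite -EFinM lee_fin.
apply: (@lt_le_trans _ _ k%:E); first by rewrite lte_fin.
rewrite leeNr.
apply: (@le_trans _ _ (ereal_sup ((fun t => - ((x t)%:E * ((z t)^-1)%:E))%E @` A))).
  by apply: ereal_inf_lbound; exists A.
apply: ge_ereal_sup => _ [t /= /hA /andP[? _] <-].
by rewrite lee_fin lerN2.
Qed.

(** * Moments of independent Bernoulli draws *)

(** Draws made simultaneously from the urns, conditionally on the present state:
    one independent Bernoulli variable per urn. *)
Section bernoulli_product.
Context {R : realType} {N : nat}.
Implicit Types (p c : 'I_N -> R) (e : {ffun 'I_N -> bool}).

Definition bern_weight p e : R := \prod_j (if e j then p j else 1 - p j).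

Definition bern_mean p (f : {ffun 'I_N -> bool} -> R) : R :=
  \sum_e bern_weight p e * f e.

Lemma bern_weight_ge0 p e : (forall j, 0 <= p j <= 1) -> 0 <= bern_weight p e.
Proof.
move=> p01; apply: prodr_ge0 => j _; have /andP[? ?] := p01 j.
by case: ifP => // _; rewrite subr_ge0.
Qed.

(** A product of independent factors: expanding the product over the urns of the
    sums over the two outcomes gives the sum over all draws. *)
Lemma bern_mean_prod p (g : 'I_N -> bool -> R) :
  bern_mean p (fun e => \prod_j g j (e j))
  = \prod_j (p j * g j true + (1 - p j) * g j false).
Proof.
transitivity (\prod_j \sum_(b : bool) (if b then p j else 1 - p j) * g j b).
  by rewrite bigA_distr_bigA; apply: eq_bigr => e _; rewrite -big_split.
by apply: eq_bigr => j _; rewrite big_bool.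
Qed.

Lemma bern_mean1 p : bern_mean p (fun=> 1) = 1.
Proof.
have := bern_mean_prod p (fun _ _ => 1).
rewrite [X in bern_mean p X](_ : _ = fun=> 1).
  by move=> ->; rewrite big1// => j _; ring.
by apply/funext => e; rewrite big1.
Qed.

Lemma bern_meanD p f g :
  bern_mean p (fun e => f e + g e) = bern_mean p f + bern_mean p g.
Proof. by rewrite /bern_mean -big_split; apply: eq_bigr => e _; rewrite mulrDr. Qed.

Lemma bern_meanZ p k f : bern_mean p (fun e => k * f e) = k * bern_mean p f.
Proof. by rewrite /bern_mean mulr_sumr; apply: eq_bigr => e _; rewrite mulrCA. Qed.

Lemma bern_mean_cst p k : bern_mean p (fun=> k) = k.
Proof.
rewrite -[RHS]mulr1 -(bern_mean1 p) -bern_meanZ; congr bern_mean.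
by apply/funext => e; rewrite mulr1.
Qed.

Lemma bern_mean_sum p (F : 'I_N -> {ffun 'I_N -> bool} -> R) :
  bern_mean p (fun e => \sum_j F j e) = \sum_j bern_mean p (F j).
Proof.
rewrite /bern_mean exchange_big; apply: eq_bigr => e _; exact: mulr_sumr.
Qed.

Lemma bern_mean_centered p j : bern_mean p (fun e => (e j)%:R - p j) = 0.
Proof.
transitivity (bern_mean p (fun e => \prod_l (if l == j then (e l)%:R - p l else 1))).
  congr bern_mean; apply/funext => e.
  by rewrite (bigD1 j)//= eqxx big1 ?mulr1// => l /negbTE ->.
rewrite (bern_mean_prod p (fun l b => if l == j then b%:R - p l else 1)).
by rewrite (bigD1 j)//= eqxx [X in X * _](_ : _ = 0) ?mul0r//=; ring.
Qed.

Lemma bern_mean_covariance p j k :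
  bern_mean p (fun e => ((e j)%:R - p j) * ((e k)%:R - p k))
  = (j == k)%:R * (p j * (1 - p j)).
Proof.
pose g l (b : bool) : R :=
  (if l == j then b%:R - p l else 1) * (if l == k then b%:R - p l else 1).
transitivity (bern_mean p (fun e => \prod_l g l (e l))).
  congr bern_mean; apply/funext => e; rewrite /g big_split/=.
  by congr (_ * _); [rewrite (bigD1 j)//=|rewrite (bigD1 k)//=];
    rewrite eqxx big1 ?mulr1// => l /negbTE ->.
rewrite bern_mean_prod (bigD1 j)//= /g eqxx.
have [<-|jk] := eqVneq j k.
  rewrite big1 => [|l /negbTE ->]; last by rewrite /=; ring.
  by rewrite /=; ring.
by rewrite [X in X * _](_ : _ = 0) ?mul0r//=; ring.
Qed.

Lemma bern_mean_affine p A c :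
  bern_mean p (fun e => A + \sum_j c j * (e j)%:R) = A + \sum_j c j * p j.
Proof.
rewrite bern_meanD bern_mean_cst bern_mean_sum; congr (_ + _).
apply: eq_bigr => j _; rewrite bern_meanZ; congr (_ * _).
transitivity (bern_mean p (fun e => ((e j)%:R - p j) + p j)).
  by congr bern_mean; apply/funext => e; rewrite subrK.
by rewrite bern_meanD bern_mean_centered bern_mean_cst add0r.
Qed.

(** Squared mean plus variance: the cross terms vanish by independence. *)
Lemma bern_mean_affine_sqr p A c :
  bern_mean p (fun e => (A + \sum_j c j * (e j)%:R) ^+ 2)
  = (A + \sum_j c j * p j) ^+ 2 + \sum_j c j ^+ 2 * (p j * (1 - p j)).
Proof.
set B := A + \sum_j c j * p j.
transitivity (bern_mean p (fun e => B ^+ 2 + (\sum_j (2 * B * c j) * ((e j)%:R - p j)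
   + \sum_j \sum_k (c j * c k) * (((e j)%:R - p j) * ((e k)%:R - p k))))).
  congr bern_mean; apply/funext => e.
  set S := \sum_j c j * ((e j)%:R - p j).
  have -> : A + \sum_j c j * (e j)%:R = B + S.
    rewrite /B -addrA -big_split/=; congr (_ + _).
    by apply: eq_bigr => j _; ring.
  have -> : \sum_j (2 * B * c j) * ((e j)%:R - p j) = 2 * B * S.
    by rewrite mulr_sumr; apply: eq_bigr => j _; rewrite mulrA.
  have -> : \sum_j \sum_k (c j * c k) * (((e j)%:R - p j) * ((e k)%:R - p k)) = S * S.
    rewrite /S mulr_suml; apply: eq_bigr => j _; rewrite mulr_sumr.
    by apply: eq_bigr => k _; ring.
  by ring.
rewrite !bern_meanD bern_mean_cst !bern_mean_sum big1 ?add0r => [|j _]; last first.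
  by rewrite bern_meanZ bern_mean_centered mulr0.
congr (_ + _); apply: eq_bigr => j _; rewrite bern_mean_sum (bigD1 j)//= big1.
  by rewrite bern_meanZ bern_mean_covariance eqxx /=; ring.
by move=> k kj; rewrite bern_meanZ bern_mean_covariance eq_sym (negbTE kj) mul0r mulr0.
Qed.

End bernoulli_product.

(** * The urn process as a sum over histories *)

Section urn_histories.
Context {R : realType}.
Variables (a b N : nat) (alpha : R).
Local Notation config := ('I_N -> nat).
Local Notation history := (seq {ffun 'I_N -> bool}).

Definition red_prob (t : nat) (x : config) (j : 'I_N) : R :=
  alpha * urn_average (fun k => red_fraction a b t (x k))
  + (1 - alpha) * red_fraction a b t (x j).

Definition add_draws (x : config) (e : {ffun 'I_N -> bool}) : config :=
  fun j => (x j + e j)%N.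

(** A history lists the draws of all urns, most recent first, so that its size is
    the current time and its tail the history one step earlier. *)
Fixpoint counts (y : history) : config :=
  if y is e :: y' then add_draws (counts y') e else fun=> a.

Fixpoint history_weight (y : history) : R :=
  if y is e :: y' then history_weight y' * bern_weight (red_prob (size y') (counts y')) e
  else 1.

Fixpoint histories (t : nat) : seq history :=
  if t is s.+1 then [seq e :: y | y <- histories s, e <- enum {ffun 'I_N -> bool}]
  else [:: [::]].

Lemma size_histories t y : y \in histories t -> size y = t.
Proof.
elim: t y => [|t IH] y; first by rewrite inE => /eqP ->.
by move=> /allpairsP[[y' e] /= [/IH <- _ ->]].
Qed.

Lemma big_histories t (F : history -> R) :
  \sum_(y <- histories t.+1) F y = \sum_(y <- histories t) \sum_e F (e :: y).
Proof.
rewrite big_allpairs_dep/=; apply: eq_bigr => y _.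
by rewrite big_enum.
Qed.

Definition urn_mean (t : nat) (f : config -> R) : R :=
  \sum_(y <- histories t) history_weight y * f (counts y).

(** The Markov property, in the form of the tower rule. *)
Lemma urn_meanS t f :
  urn_mean t.+1 f
  = urn_mean t (fun x => bern_mean (red_prob t x) (fun e => f (add_draws x e))).
Proof.
rewrite /urn_mean big_histories big_seq [RHS]big_seq; apply: eq_bigr => y yt.
rewrite /bern_mean mulr_sumr; apply: eq_bigr => e _ /=.
by rewrite (size_histories yt) mulrA.
Qed.

Lemma urn_meanD t f g :
  urn_mean t (fun x => f x + g x) = urn_mean t f + urn_mean t g.
Proof. by rewrite /urn_mean -big_split; apply: eq_bigr => e _; rewrite mulrDr. Qed.

Lemma urn_meanZ t k f : urn_mean t (fun x => k * f x) = k * urn_mean t f.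
Proof. by rewrite /urn_mean mulr_sumr; apply: eq_bigr => e _; rewrite mulrCA. Qed.

Lemma urn_mean1 t : urn_mean t (fun=> 1) = 1.
Proof.
elim: t => [|t IH]; first by rewrite /urn_mean/= big_seq1 mulr1.
rewrite urn_meanS -[RHS]IH; congr urn_mean; apply/funext => x; exact: bern_mean1.
Qed.

Lemma urn_mean0 f : urn_mean 0 f = f (fun=> a).
Proof. by rewrite /urn_mean/= big_seq1 mul1r. Qed.

End urn_histories.

(** * Conditional moments of the urns *)

Section urn_moments.
Context {R : realType}.
Variables (a b N : nat) (alpha : R).
Hypotheses (a1 : (1 <= a)%N) (b1 : (1 <= b)%N) (N2 : (2 <= N)%N).
Hypotheses (alpha0 : 0 < alpha) (alpha1 : alpha <= 1).
Local Notation config := ('I_N -> nat).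
Local Notation urn_mean := (@urn_mean R a b N alpha).
Local Notation red_prob := (@red_prob R a b N alpha).
Local Notation histories := (@histories N).
Local Notation counts := (@counts a N).

Let r t : R := (t + (a + b))%:R.
Let z t (x : config) j : R := red_fraction a b t (x j).
Let Z t x : R := urn_average (z t x).

Let N_gt0 : 0 < N%:R :> R.
Proof. by rewrite ltr0n (leq_trans _ N2). Qed.
Let r_gt0 t : 0 < r t.
Proof. by rewrite /r ltr0n addnA addn_gt0 b1 orbT. Qed.
Let rS t : r t.+1 = r t + 1.
Proof. by rewrite /r addSn -natr1. Qed.

(** Outside these configurations the drawing probabilities can leave [0, 1]. *)
Definition reachable t (x : config) := forall j, (x j <= a + t)%N.

Lemma counts_reachable y : reachable (size y) (counts y).
Proof.
elim: y => [|e y IH] j /=; first by rewrite addn0.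
by rewrite /add_draws addnS -addn1; apply: leq_add => //; case: (e j).
Qed.

Lemma frac_itv t x j : reachable t x -> 0 <= z t x j <= 1.
Proof.
move=> xt; rewrite /z /red_fraction divr_ge0//= ler_pdivrMr ?(r_gt0 t)// mul1r ler_nat.
by apply: leq_trans (xt j) _; rewrite addnC leq_add2l leq_addr.
Qed.

Lemma average_itv t x : reachable t x -> 0 <= Z t x <= 1.
Proof.
move=> xt; rewrite /Z /urn_average mulr_ge0 ?invr_ge0 ?ler0n//=; last first.
  by apply: sumr_ge0 => j _; case/andP: (frac_itv j xt).
rewrite mulrC ler_pdivrMr// mul1r.
apply: (@le_trans _ _ (\sum_(j < N) 1)); last by rewrite sumr_const card_ord.
by apply: ler_sum => j _; case/andP: (frac_itv j xt).
Qed.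

Lemma red_prob_itv t x j : reachable t x -> 0 <= red_prob t x j <= 1.
Proof.
move=> xt; rewrite /red_prob -/(z t x j) -/(Z t x).
have /andP[? ?] := frac_itv j xt; have /andP[? ?] := average_itv xt.
have := alpha0; have := alpha1; nra.
Qed.

Lemma sum_red_prob t x : \sum_j red_prob t x j = N%:R * Z t x.
Proof.
rewrite /red_prob big_split/= sumr_const card_ord -mulr_sumr.
have -> : \sum_j red_fraction a b t (x j) = N%:R * Z t x :> R.
  by rewrite /Z /urn_average mulVKf// gt_eqF.
by rewrite -/(z t x) -/(Z t x) -mulr_natl; ring.
Qed.

Lemma history_weight_ge0 (y : seq {ffun 'I_N -> bool}) : 0 <= history_weight a b alpha y.
Proof.
elim: y => [|e y IH] //=; rewrite mulr_ge0// bern_weight_ge0// => j.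
by apply: red_prob_itv; exact: counts_reachable.
Qed.

Lemma le_urn_mean t f g : (forall x, reachable t x -> f x <= g x) ->
  urn_mean t f <= urn_mean t g.
Proof.
move=> fg; rewrite /urn_mean big_seq [leRHS]big_seq; apply: ler_sum => y yt.
by rewrite ler_wpM2l ?history_weight_ge0// fg// -(size_histories yt); exact: counts_reachable.
Qed.

Lemma red_fractionS t (k : nat) (c : bool) :
  red_fraction a b t.+1 (k + c) = (r t * red_fraction a b t k + c%:R) / (r t + 1).
Proof.
by rewrite /red_fraction -/(r t.+1) -/(r t) rS natrD [r t * _]mulrC divfK// gt_eqF.
Qed.

Lemma averageS t x e :
  Z t.+1 (add_draws x e) = r t * Z t x / (r t + 1) + \sum_j (N%:R^-1 / (r t + 1)) * (e j)%:R.
Proof.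
rewrite /Z /urn_average /z /add_draws.
under eq_bigr do rewrite red_fractionS mulrDl.
rewrite big_split/= -mulr_suml -mulr_sumr mulrDr; congr (_ + _); first by ring.
by rewrite -mulr_suml mulrA -mulr_sumr; ring.
Qed.

Definition deviation t x i : R := z t x i - Z t x.

Definition draw_weight (i j : 'I_N) : R := (j == i)%:R - N%:R^-1.

(** The conditional variance of Y_t(i) minus the average of the Y_t(j). *)
Definition deviation_noise t i x : R :=
  \sum_j draw_weight i j ^+ 2 * (red_prob t x j * (1 - red_prob t x j)).

Lemma deviationS t x e i :
  deviation t.+1 (add_draws x e) i
  = r t * deviation t x i / (r t + 1) + \sum_j (draw_weight i j / (r t + 1)) * (e j)%:R.
Proof.
rewrite /deviation averageS /z /add_draws red_fractionS.
have -> : \sum_j (draw_weight i j / (r t + 1)) * (e j)%:R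
  = (e i)%:R / (r t + 1) - \sum_j (N%:R^-1 / (r t + 1)) * (e j)%:R.
  rewrite (bigD1 i)//= [in RHS](bigD1 i)//= /draw_weight eqxx /=.
  rewrite (eq_bigr (fun j => - (N%:R^-1 / (r t + 1) * (e j)%:R))) ?sumrN; last first.
    by move=> j /negbTE -> /=; ring.
  by ring.
by ring.
Qed.

(** The conditional mean of Y_t(i) minus the average of the Y_t(j) is (1 - alpha)
    times the deviation, because the drawing probabilities average to Z_t. So the
    deviation is multiplied on average by (r + 1 - alpha) / (r + 1). *)
Lemma bern_mean_deviation_sqr t x i :
  bern_mean (red_prob t x) (fun e => deviation t.+1 (add_draws x e) i ^+ 2)
  = damped_step alpha (r t) (deviation t x i ^+ 2) (deviation_noise t i x).
Proof.
under eq_fun do rewrite deviationS.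
rewrite bern_mean_affine_sqr /damped_step; congr (_ + _).
  rewrite -exprMn; congr (_ ^+ 2).
  have -> : \sum_j (draw_weight i j / (r t + 1)) * red_prob t x j
     = (red_prob t x i - Z t x) / (r t + 1).
    transitivity ((red_prob t x i - N%:R^-1 * \sum_j red_prob t x j) / (r t + 1)).
      rewrite (bigD1 i)//= [in RHS](bigD1 i)//= /draw_weight eqxx /=.
      rewrite (eq_bigr (fun j => - (N%:R^-1 / (r t + 1) * red_prob t x j))) ?sumrN; last first.
        by move=> j /negbTE -> /=; ring.
      by rewrite -mulr_sumr; ring.
    by rewrite sum_red_prob mulKf// gt_eqF.
  rewrite /red_prob -/(z t x i) -/(Z t x) /deviation; field.
  by rewrite gt_eqF// addr_gt0.
rewrite /deviation_noise mulr_suml; apply: eq_bigr => j _; rewrite expr_div_n; ring.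
Qed.

Lemma urn_mean_deviationS t i :
  urn_mean t.+1 (fun x => deviation t.+1 x i ^+ 2)
  = damped_step alpha (r t) (urn_mean t (fun x => deviation t x i ^+ 2))
      (urn_mean t (deviation_noise t i)).
Proof.
rewrite urn_meanS; under eq_fun do rewrite bern_mean_deviation_sqr.
by rewrite urn_meanD urn_meanZ mulrC; congr (_ + _); rewrite mulrC -urn_meanZ;
  congr urn_mean; apply/funext => x; rewrite mulrC.
Qed.

Lemma deviation_noise_le1 t i x : reachable t x -> deviation_noise t i x <= 1.
Proof.
move=> xt; apply: (@le_trans _ _ (\sum_j draw_weight i j ^+ 2)).
  apply: ler_sum => j _; have /andP[p0 p1] := red_prob_itv j xt.
  by rewrite ler_piMr ?sqr_ge0//; nra.
have -> : \sum_j draw_weight i j ^+ 2 = 1 - N%:R^-1.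
  rewrite (bigD1 i)//= /draw_weight eqxx /=.
  have h : \sum_(j < N) (N%:R^-1 : R) ^+ 2 = N%:R^-1.
    by rewrite sumr_const card_ord -mulr_natl; field; rewrite gt_eqF.
  rewrite (eq_bigr (fun j => N%:R^-1 ^+ 2)) => [|j /negbTE -> /=]; last by ring.
  move: h; rewrite (bigD1 i)//= => h.
  rewrite (_ : (1 - N%:R^-1) ^+ 2 = 1 - 2 * N%:R^-1 + N%:R^-1 ^+ 2); last by rewrite /=; ring.
  by rewrite -addrA h; ring.
by rewrite gerBl invr_ge0 ltW.
Qed.

(** With N >= 2 every urn has a coefficient of size at least 1 / N in the noise of
    urn i, and the interaction keeps every drawing probability p away from 0 and 1
    whenever Z_t is: p >= alpha Z_t and 1 - p >= alpha (1 - Z_t). *)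
Lemma deviation_noise_ge t i x : reachable t x ->
  alpha ^+ 2 / N%:R * (Z t x * (1 - Z t x)) <= deviation_noise t i x.
Proof.
move=> xt; apply: (@le_trans _ _
  (\sum_(j < N) N%:R^-1 ^+ 2 * (alpha ^+ 2 * (Z t x * (1 - Z t x))))).
  rewrite sumr_const card_ord -mulr_natl le_eqVlt; apply/orP; left; apply/eqP.
  by field; rewrite gt_eqF.
apply: ler_sum => j _.
have /andP[Z0 Z1] := average_itv xt.
have /andP[z0 z1] := frac_itv j xt.
apply: ler_pM; rewrite ?sqr_ge0//; first by rewrite mulr_ge0 ?sqr_ge0// mulr_ge0// subr_ge0.
  rewrite /draw_weight; case: (j == i); last by rewrite sub0r sqrrN.
  rewrite ler_pXn2r// ?nnegrE ?invr_ge0 ?ler0n//=; last first.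
    by rewrite subr_ge0 ltW// invf_lt1// ltr1n.
  have : N%:R^-1 <= 2^-1 :> R by rewrite lef_pV2 ?posrE// ler_nat.
  by rewrite /=; lra.
have A0 := alpha0; have A1 := alpha1.
have -> : alpha ^+ 2 * (Z t x * (1 - Z t x)) = (alpha * Z t x) * (alpha * (1 - Z t x)) by ring.
apply: ler_pM.
- by apply: mulr_ge0 => //; exact: ltW.
- by apply: mulr_ge0; rewrite ?subr_ge0//; exact: ltW.
- by rewrite /red_prob -/(z t x j) -/(Z t x); nra.
- by rewrite /red_prob -/(z t x j) -/(Z t x); nra.
Qed.

(** Concavity of p (1 - p), the drawing probabilities having mean Z_t. *)
Lemma sum_red_prob_var t x :
  \sum_j red_prob t x j * (1 - red_prob t x j) <= N%:R * (Z t x * (1 - Z t x)).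
Proof.
have h : 0 <= \sum_j (red_prob t x j - Z t x) ^+ 2 by apply: sumr_ge0 => j _; exact: sqr_ge0.
rewrite -subr_ge0; apply: (le_trans h); rewrite le_eqVlt; apply/orP; left; apply/eqP.
transitivity (\sum_j ((red_prob t x j - 2 * Z t x * red_prob t x j + Z t x ^+ 2)
    - red_prob t x j * (1 - red_prob t x j))).
  by apply: eq_bigr => j _; ring.
rewrite sumrB big_split/= sumrB -mulr_sumr sum_red_prob sumr_const card_ord -mulr_natl.
by congr (_ - _); ring.
Qed.

(** Z_t is a martingale, so the mean of Z_t (1 - Z_t) decreases by the conditional
    variance of Z_(t+1), which is at most Z_t (1 - Z_t) / (r + 1)^2. *)
Lemma bern_mean_spread t x : reachable t x ->
  (1 - (r t + 1) ^- 2) * (Z t x * (1 - Z t x))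
  <= bern_mean (red_prob t x)
       (fun e => Z t.+1 (add_draws x e) * (1 - Z t.+1 (add_draws x e))).
Proof.
move=> xt.
have meanE : r t * Z t x / (r t + 1) + \sum_j (N%:R^-1 / (r t + 1)) * red_prob t x j = Z t x.
  rewrite -mulr_sumr sum_red_prob; field.
  by rewrite !gt_eqF// addr_gt0.
rewrite [leRHS](_ : _ = bern_mean (red_prob t x)
   (fun e => Z t.+1 (add_draws x e) + -1 * Z t.+1 (add_draws x e) ^+ 2)); last first.
  by congr bern_mean; apply/funext => e; ring.
under eq_fun do rewrite averageS.
rewrite bern_meanD bern_meanZ bern_mean_affine bern_mean_affine_sqr meanE.
set S := \sum_j _.
have hS : S <= (r t + 1) ^- 2 * (Z t x * (1 - Z t x)).
  have -> : S = (r t + 1) ^- 2 * (N%:R ^- 2 * \sum_j red_prob t x j * (1 - red_prob t x j)).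
    rewrite /S -mulr_sumr mulrA; congr (_ * _); field.
    by rewrite !gt_eqF// addr_gt0.
  rewrite ler_pM2l ?invr_gt0 ?exprn_gt0 ?addr_gt0//.
  apply: (@le_trans _ _ (N%:R ^- 2 * (N%:R * (Z t x * (1 - Z t x))))).
    by rewrite ler_wpM2l ?invr_ge0 ?exprn_ge0 ?ler0n// sum_red_prob_var.
  have /andP[Z0 Z1] := average_itv xt.
  rewrite (mulrA (N%:R ^- 2)) ler_piMl//; first by apply: mulr_ge0; rewrite ?subr_ge0.
  rewrite expr2 invfM -mulrA mulVf ?gt_eqF// mulr1 invf_le1//.
  by rewrite ler1n (leq_trans _ N2).
lra.
Qed.

(** Half of Z_0 (1 - Z_0), because the telescoping factor 1 + 1 / r is at most 2
    at time 0. *)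
Definition spread_bound : R := (a%:R / (a + b)%:R * (1 - a%:R / (a + b)%:R)) / 2.

Lemma spread_bound_gt0 : 0 < spread_bound.
Proof.
have s0 : 0 < (a + b)%:R :> R by rewrite ltr0n addn_gt0 a1.
rewrite divr_gt0// mulr_gt0//; first by rewrite divr_gt0// ltr0n.
by rewrite subr_gt0 ltr_pdivrMr// mul1r ltr_nat -addn1 leq_add2l.
Qed.

(** The product of the factors 1 - 1 / n^2 telescopes: 1 + 1 / r is multiplied
    exactly by 1 - 1 / (r + 1)^2 when r increases by 1. Hence the mean of
    Z_t (1 - Z_t) never falls below a positive constant. *)
Lemma urn_mean_spread_ge t :
  spread_bound * (1 + (r t)^-1) <= urn_mean t (fun x => Z t x * (1 - Z t x)).
Proof.
elim: t => [|t IH].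
  rewrite urn_mean0.
  have -> : Z 0 (fun=> a) = a%:R / (a + b)%:R.
    by rewrite /Z /urn_average sumr_const card_ord -[X in _ * X]mulr_natl mulKf ?gt_eqF.
  rewrite [leRHS](_ : _ = spread_bound * 2); last by rewrite /spread_bound divfK.
  rewrite ler_pM2l ?spread_bound_gt0//.
  have : (r 0)^-1 <= 1 by rewrite invf_le1// ler1n addn_gt0 addn_gt0 a1 orbT.
  by lra.
rewrite urn_meanS.
apply: (@le_trans _ _
  (urn_mean t (fun x => (1 - (r t + 1) ^- 2) * (Z t x * (1 - Z t x))))); last first.
  by apply: le_urn_mean => x; exact: bern_mean_spread.
rewrite urn_meanZ.
have h : 0 <= 1 - (r t + 1) ^- 2.
  rewrite subr_ge0 invf_le1 ?exprn_gt0 ?addr_gt0//.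
  by rewrite exprn_ege1// lerDr ltW.
apply: le_trans (ler_wpM2l h IH).
rewrite rS le_eqVlt; apply/orP; left; apply/eqP.
by move: (r t) (r_gt0 t) => s s0; field; rewrite !gt_eqF// addr_gt0.
Qed.

Lemma urn_mean_noise_itv t i :
  alpha ^+ 2 / N%:R * spread_bound <= urn_mean t (deviation_noise t i) <= 1.
Proof.
apply/andP; split; last first.
  rewrite -(@urn_mean1 R a b N alpha t); apply: le_urn_mean => x; exact: deviation_noise_le1.
apply: (@le_trans _ _
  (urn_mean t (fun x => alpha ^+ 2 / N%:R * (Z t x * (1 - Z t x))))); last first.
  by apply: le_urn_mean => x; exact: deviation_noise_ge.
rewrite urn_meanZ ler_wpM2l ?divr_ge0 ?sqr_ge0//.
apply: le_trans (urn_mean_spread_ge t).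
by rewrite ler_peMr ?lerDl ?invr_ge0 ?ltW// spread_bound_gt0.
Qed.

End urn_moments.

(** * The law of the histories *)

Section path_decomposition.
Context {R : realType}.
Variables (a b N : nat) (alpha : R).
Local Notation config := ('I_N -> nat).
Local Notation history := (seq {ffun 'I_N -> bool}).

Definition draws (u : nat -> nat -> R) (t : nat) (x : config) : {ffun 'I_N -> bool} :=
  [ffun j : 'I_N => u t.+1 j <= red_prob a b alpha t x j].

Fixpoint realises (u : nat -> nat -> R) (y : history) : bool :=
  if y is e :: y' then realises u y' && (draws u (size y') (counts a y') == e)
  else true.

(** Exactly one history of length t is realised, and it determines the state. This
    identity holds for every realisation u, before any probability. *)
Lemma urn_red_sum_histories u t (f : config -> R) :
  f (urn_red a b alpha u t) = \sum_(y <- histories N t) (realises u y)%:R * f (counts a y).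
Proof.
elim: t f => [|t IH] f; first by rewrite /= big_seq1 mul1r.
pose g (x : config) := f (add_draws x (draws u t x)).
transitivity (g (urn_red a b alpha u t)).
  by congr f; apply/funext => j; rewrite /add_draws ffunE.
rewrite IH big_histories big_seq [RHS]big_seq; apply: eq_bigr => y yt.
rewrite (bigD1 (draws u t (counts a y)))//= (size_histories yt) eqxx andbT.
by rewrite big1 ?addr0// => e; rewrite eq_sym => /negbTE ->; rewrite andbF mul0r.
Qed.

End path_decomposition.

Section uniform_threshold.
Context {d : measure_display} {T : measurableType d} {R : realType}.
Variables (P : probability T R) (X : {RV P >-> R}).
Hypothesis hX : uniform01 X.

Definition draw_event (p : R) (c : bool) : set R :=
  if c then `]-oo, p]%classic else `]p, +oo[%classic.

Lemma measurable_draw_event p c : measurable (draw_event p c).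
Proof. by case: c; exact: measurable_itv. Qed.

Lemma draw_eventE p c x : draw_event p c x <-> ((x <= p) = c).
Proof.
case: c; rewrite /draw_event /= in_itv/= ?andbT; first by [].
by rewrite ltNge; split => [/negbTE|->].
Qed.

Lemma uniform01_draw_event p c : 0 <= p <= 1 ->
  P (X @^-1` draw_event p c) = (if c then p else 1 - p)%:E.
Proof.
move=> /andP[p0 p1].
have Ple : P (X @^-1` `]-oo, p]) = p%:E.
  have -> : P (X @^-1` `]-oo, p]) = distribution P X `]-oo, p] by [].
  rewrite hX// /uniform_prob integral_uniform_pdf.
  have -> : `]-oo, p]%classic `&` `[0, 1]%classic = `[0, p]%classic :> set R.
    apply/seteqP; split => x /=; rewrite !in_itv/=; first by move=> [-> /andP[-> _]].
    by move=> /andP[-> xp]; rewrite xp (le_trans xp).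
  rewrite (eq_integral (fun=> 1%:E)) => [|x].
    rewrite integral_cst//= mul1e lebesgue_measure_itv/= lte_fin.
    by case: ltgtP p0 => // [_|<-]; rewrite ?oppr0 ?adde0 ?sube0.
  rewrite inE /= in_itv/= => /andP[x0 xp].
  by rewrite /uniform_pdf x0 (le_trans xp p1) subr0 invr1.
case: c => //.
have -> : X @^-1` draw_event p false = ~` (X @^-1` `]-oo, p]).
  apply/seteqP; split => w /=; rewrite !in_itv/= andbT ltNge; first by move/negP.
  by move=> /negP.
by rewrite probability_setC ?Ple// -[X in measurable X]setTI; exact: measurable_funP.
Qed.

End uniform_threshold.

Section path_law.
Context {d : measure_display} {T : measurableType d} {R : realType}.
Variables (P : probability T R) (U : nat -> nat -> {RV P >-> R}).
Hypothesis hU : iid_uniform01 U.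
Variables (a b N : nat) (alpha : R).
Hypotheses (b1 : (1 <= b)%N) (N2 : (2 <= N)%N).
Hypotheses (alpha0 : 0 < alpha) (alpha1 : alpha <= 1).
Local Notation config := ('I_N -> nat).
Local Notation history := (seq {ffun 'I_N -> bool}).

Let path w s j : R := U s j w.

Definition history_event (y : history) : set T :=
  [set w | realises a b alpha (path w) y].

Let level (y : history) (e : {ffun 'I_N -> bool}) (j : 'I_N) : set R :=
  draw_event (red_prob a b alpha (size y) (counts a y) j) (e j).

Lemma history_event_cons e y : history_event (e :: y) =
  history_event y `&` \bigcap_(j in [set: 'I_N]) (U (size y).+1 j @^-1` level y e j).
Proof.
apply/seteqP; split => w; rewrite /history_event /=.
  move=> /andP[wy /eqP we]; split => // j _; apply/draw_eventE.
  by rewrite -we ffunE.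
move=> [-> we] /=; apply/eqP/ffunP => j; rewrite ffunE.
by apply/draw_eventE; exact: we.
Qed.

Lemma measurable_preimage_rv s j (B : set R) : measurable B -> measurable (U s j @^-1` B).
Proof. by move=> mB; rewrite -[X in measurable X]setTI; exact: measurable_funP. Qed.

Lemma measurable_history_event y : measurable (history_event y).
Proof.
elim: y => [|e y IH]; first by rewrite (_ : history_event _ = setT)//; exact/seteqP.
rewrite history_event_cons; apply: measurableI => //.
apply: fin_bigcap_measurable => // j _.
by apply: measurable_preimage_rv; exact: measurable_draw_event.
Qed.

(** The events on the variables U(s, j) with s beyond the current time are carried
    along so that the induction can absorb, at each step, the variables of one
    more time into a single application of mutual independence. *)
Lemma history_event_indep_future y (l : seq (nat * nat)) (B : nat * nat -> set R) :
  uniq l -> (forall k, k \in l -> (size y < k.1)%N) -> (forall k, measurable (B k)) ->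
  P (history_event y `&` \bigcap_(k in [set` l]) (U k.1 k.2 @^-1` B k))
  = ((history_weight a b alpha y)%:E * \prod_(k <- l) P (U k.1 k.2 @^-1` B k))%E.
Proof.
elim: y l B => [|e y IH] l B ul lS mB.
  rewrite (_ : history_event _ = setT) ?setTI ?mul1e; last exact/seteqP.
  exact: hU.1.
pose s := (size y).+1.
pose now := [seq (s, val j) | j <- enum 'I_N].
(* The thresholds of the newest draws are read off the older history, so for
   this fixed history they are constants; k.2 is a bare number, whence insub. *)
pose B' (k : nat * nat) :=
  if k.1 == s then (if insub k.2 is Some j then level y e j else setT) else B k.
have B'now j : B' (s, val j) = level y e j by rewrite /B' /= eqxx valK.
have B'l k : k \in l -> B' k = B k.
  by move=> /lS /= sk; rewrite /B' gtn_eqF.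
have mB' k : measurable (B' k).
  rewrite /B'; case: ifP => // _; case: insubP => // j _ _; exact: measurable_draw_event.
have ul' : uniq (now ++ l).
  rewrite cat_uniq ul andbT map_inj_uniq ?enum_uniq/=; last by move=> j k [] /val_inj.
  apply/hasPn => k /lS /= sk; apply/mapP => -[j _ kE].
  by move: sk; rewrite kE /= ltnn.
have lS' k : k \in now ++ l -> (size y < k.1)%N.
  rewrite mem_cat => /orP[/mapP[j _ ->]//|/lS/=]; exact: ltnW.
have -> : history_event (e :: y) `&` \bigcap_(k in [set` l]) (U k.1 k.2 @^-1` B k) =
  history_event y `&` \bigcap_(k in [set` now ++ l]) (U k.1 k.2 @^-1` B' k).
  rewrite history_event_cons -setIA; congr (_ `&` _); apply/seteqP; split => w.
    move=> [wn wl] k /=; rewrite mem_cat => /orP[/mapP[j _ ->]|kl].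
      by rewrite B'now; exact: wn.
    by rewrite B'l//; exact: wl.
  move=> h; split => [j _|k kl].
    have := h (s, val j); rewrite B'now; apply; rewrite /= mem_cat map_f ?mem_enum//.
  by have := h k; rewrite B'l//; apply; rewrite /= mem_cat kl orbT.
rewrite IH// big_cat/= muleA; congr (_ * _)%E; last first.
  by rewrite big_seq [RHS]big_seq; apply: eq_bigr => k kl; rewrite B'l.
rewrite EFinM; congr (_ * _)%E.
rewrite big_map big_enum/= /bern_weight -prodEFin; apply: eq_bigr => j _.
rewrite B'now /level uniform01_draw_event//; first exact: hU.2.
by apply: red_prob_itv => //; exact: counts_reachable.
Qed.

Lemma prob_history_event y : P (history_event y) = (history_weight a b alpha y)%:E.
Proof.
have := @history_event_indep_future y [::] (fun=> setT) isT.
rewrite big_nil mule1 => <-//.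
by congr (P _); rewrite set_nil bigcap_set0 setIT.
Qed.

Lemma expectation_urn t (f : config -> R) :
  ('E_P[fun w => f (urn_red a b alpha (path w) t)] = (urn_mean a b alpha t f)%:E)%E.
Proof.
have mA y := measurable_history_event y.
have LA y : (\1_(history_event y) : T -> R) \in Lfun P 1.
  apply/Lfun1_integrable; exact: integrable_indic.
rewrite [X in ('E_P[X])%E](_ : _ = \sum_(h <- [seq f (counts a y) \o* \1_(history_event y)
    | y <- histories N t]) h); last first.
  apply/funext => w; rewrite (urn_red_sum_histories _ _ _ _ _ f) big_map fct_sumE.
  apply: eq_bigr => y _ /=; congr (_ * _).
  rewrite indicE; congr ((nat_of_bool _)%:R).
  by apply/idP/idP; rewrite inE.
rewrite expectation_sum; last first.
  by move=> h /mapP[y _ ->]; exact: Lfun_scale.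
rewrite big_map /urn_mean -sumEFin; apply: eq_bigr => y _.
by rewrite expectationZl// expectation_indic// prob_history_event muleC.
Qed.

End path_law.

(** * Rates for the deviation of an urn *)

Unset Implicit Arguments.

Theorem theorem1 (R : realType) (d : measure_display) (T : measurableType d)
    (P : probability T R) (U : nat -> nat -> {RV P >-> R})
    (a b N : nat) (alpha : R) (i : 'I_N)
    (hU : iid_uniform01 U)
    (ha : (1 <= a)%N) (hb : (1 <= b)%N) (hN : (2 <= N)%N)
    (halpha0 : 0 < alpha) (halpha1 : alpha <= 1) :
  let Zi (t : nat) (w : T) : R :=
    urn_frac a b alpha (fun s j => U s j w) t i in
  let Z (t : nat) (w : T) : R :=
    total_frac a b N alpha (fun s j => U s j w) t in
  let msd (t : nat) : \bar R := ('E_P[(fun w => (Zi t w - Z t w) ^+ 2)%R])%E in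
  [/\ alpha < 2^-1 ->
        same_order msd (fun t => t%:R `^ (- (2 * alpha))),
      alpha = 2^-1 ->
        same_order msd (fun t => t%:R^-1 * ln t%:R)
    & 2^-1 < alpha ->
        same_order msd (fun t => t%:R^-1)].
Proof.
move=> Zi Z msd.
pose y t : R := urn_mean a b alpha t (fun x : 'I_N -> nat => deviation a b t x i ^+ 2).
have msdE : msd = fun t => (y t)%:E.
  apply/funext => t; rewrite -(expectation_urn hU a hb hN halpha0 halpha1).
  by [].
pose v t := urn_mean a b alpha t (deviation_noise a b alpha t i).
have yS t : y t.+1 = damped_step alpha (t + (a + b))%:R (y t) (v t).
  exact: urn_mean_deviationS.
have m2 : (2 <= a + b)%N by rewrite -(addn1 1); apply: leq_add.
have c0 : 0 < alpha ^+ 2 / N%:R * spread_bound a b :> R.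
  by rewrite mulr_gt0 ?spread_bound_gt0// divr_gt0 ?exprn_gt0// ltr0n (leq_trans _ hN).
have hv t : alpha ^+ 2 / N%:R * spread_bound a b <= v t <= 1.
  exact: urn_mean_noise_itv.
have y0 : 0 <= y 0%N by rewrite /y urn_mean0 sqr_ge0.
rewrite msdE; split => ha'; apply: same_order_of_comparable.
- apply: comparable_eventually_trans (comparable_shift_powN (a + b) _).
    exact: (damped_subcritical halpha0 halpha1 m2 c0 y0 hv yS ha').
  by rewrite mulr_ge0// ltW.
- by move=> t t2; rewrite powR_gt0// ltr0n ltnW.
- apply: comparable_eventually_trans (comparable_shift_log (a + b)).
  exact: (damped_critical m2 c0 y0 hv yS ha').
- move=> t t2; rewrite mulr_gt0 ?invr_gt0 ?ltr0n 1?ltnW//.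
  by rewrite ln_gt0// ltr1n.
- apply: comparable_eventually_trans (comparable_shift_inv (a + b)).
  exact: (damped_supercritical halpha0 halpha1 m2 c0 y0 hv yS ha').
- by move=> t t2; rewrite invr_gt0 ltr0n ltnW.
Qed.
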